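(* Let $F$ be a graph with maximum degree at least two, and for each $n \ge 1$ let $\mathcal{F}_n$ be the down-set of $F$-free graphs on vertex-set $[n]$. Then there are constants $\gamma=\gamma(F)>0$ and $n_0=n_0(F)\ge 1$ such that for all $n \ge n_0$ both $$q(\mathcal{F}_n) \ge n^{\gamma}\, p_{\mathrm c}(\mathcal{F}_n) \qquad\text{and}\qquad q_{\mathrm f}(\mathcal{F}_n) \ge n^{\gamma}\, p_{\mathrm c}(\mathcal{F}_n),$$ where $p_{\mathrm c}$, $q$ and $q_{\mathrm f}$ denote the threshold, the expectation threshold and the fractional expectation threshold, respectively.
   Context: Graphs are finite and simple, and $[n]=\{1,\dots,n\}$. A graph is $F$-free if it contains no (not necessarily induced) subgraph isomorphic to $F$. A graph on vertex-set $[n]$ is identified with its edge set, i.e. with a subset of $X=\binom{[n]}{2}$, so $\mathcal{F}_n\subseteq 2^X$. Let $X$ be a finite set. For $p\in[0,1]$, $\mu_p$ is the product measure on $2^X$ given by $\mu_p(S)=p^{|S|}(1-p)^{|X\setminus S|}$ for $S\subseteq X$, and $\mu_p(\mathcal{F})=\sum_{S\in\mathcal{F}}\mu_p(S)$ for $\mathcal{F}\subseteq 2^X$. A family $\mathcal{F}\subseteq 2^X$ is a down-set if $A\in\mathcal{F}$ and $B\subseteq A$ imply $B\in\mathcal{F}$. The cases $\mathcal{F}=\emptyset$ and $\mathcal{F}=2^X$ are excluded. For a down-set $\mathcal{F}$: - The threshold $p_{\mathrm c}(\mathcal{F})$ is the unique $p\in[0,1]$ with $\mu_p(\mathcal{F})=1/2$.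 - The expectation threshold $q(\mathcal{F})$ is the smallest $p\in[0,1]$ for which there exists $\mathcal{G}\subseteq 2^X$ with $\sum_{S\in\mathcal{G}}(1-p)^{|X\setminus S|}\le 1/2$ and $\mathcal{F}\subseteq\mathcal{G}^{\downarrow}$, where $\mathcal{G}^{\downarrow}=\bigcup_{S\in\mathcal{G}}\{T: T\subseteq S\}$. - The fractional expectation threshold $q_{\mathrm f}(\mathcal{F})$ is the smallest $p\in[0,1]$ for which there exists a function $\lambda:2^X\to[0,\infty)$ with $\sum_{S\subseteq X}\lambda(S)(1-p)^{|X\setminus S|}\le 1/2$ and $\sum_{S\supseteq A}\lambda(S)\ge 1$ for all $A\in\mathcal{F}$ (the sum being over $S \subseteq X$ with $S\supseteq A$). The convention $0^0=1$ is used. *)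

(* Defs.v *)
From HB Require Import structures.
From mathcomp Require Import all_boot all_order all_algebra.
From mathcomp Require Import all_classical all_reals all_analysis.

Set Implicit Arguments.
Unset Strict Implicit.
Unset Printing Implicit Defensive.

Import Order.TTheory GRing.Theory Num.Theory.
Import numFieldNormedType.Exports.

Local Open Scope classical_set_scope.
Local Open Scope ring_scope.

Section Families.
Context {R : realType} {X : finType}.
Implicit Types (p : R) (S A B : {set X}) (F G : {set {set X}}).

Definition down_set F : bool :=
  [forall A in F, forall B : {set X}, (B \subset A) ==> (B \in F)].

Definition down_closure G : {set {set X}} := (\bigcup_(S in G) powerset S)%SET.

Definition mu_set p S : R := p ^+ #|S| * (1 - p) ^+ #|~: S|%SET.

Definition mu p F : R := \sum_(S in F) mu_set p S.

(* The default value 0 is used only if no such p exists; see [thresholdP]. *)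
Definition threshold F : R :=
  xget 0 [set p : R | 0 <= p <= 1 /\ mu p F = 1 / 2].

(* The least element of A; the default value 0 is used only if there is none,
   see [expectation_thresholdP] and [fractional_expectation_thresholdP]. *)
Definition smallest (A : set R) : R := xget 0 (A `&` lbound A).

Definition expectation_feasible F : set R :=
  [set p : R | 0 <= p <= 1 /\
     exists G : {set {set X}},
       \sum_(S in G) (1 - p) ^+ #|~: S|%SET <= 1 / 2 /\
       F \subset down_closure G].

Definition expectation_threshold F : R := smallest (expectation_feasible F).

Definition fractional_feasible F : set R :=
  [set p : R | 0 <= p <= 1 /\
     exists lambda : {set X} -> R,
       [/\ forall S, 0 <= lambda S,
           \sum_(S : {set X}) lambda S * (1 - p) ^+ #|~: S|%SET <= 1 / 2
         & forall A, A \in F ->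
             1 <= \sum_(S : {set X} | A \subset S) lambda S]].

Definition fractional_expectation_threshold F : R :=
  smallest (fractional_feasible F).

End Families.

(* A graph on the vertex set V is its set of edges, the edges being the
   two-element subsets of V; it is thus simple by construction. *)
Definition edge (V : finType) : finType := {a : {set V} | #|a| == 2%N}.

Definition graph (V : finType) : finType := {set edge V}.

Definition adj (V : finType) (G : graph V) : rel V :=
  [rel x y | [exists a in G, val a == [set x; y]%SET]].

Definition degree (V : finType) (G : graph V) (x : V) : nat :=
  #|[set y | adj G x y]%SET|.

Definition max_degree (V : finType) (G : graph V) : nat :=
  \max_(x : V) degree G x.

(* The pair (U, H) is a subgraph of G with vertex set U and edge set H. *)
Definition is_subgraph (V : finType) (U : {set V}) (H G : graph V) : bool :=
  (H \subset G) && [forall a in H, val a \subset U].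

(* f is an isomorphism from the graph F onto the graph (U, H). *)
Definition is_isomorphism (W V : finType) (F : graph W) (U : {set V})
    (H : graph V) (f : {ffun W -> V}) : bool :=
  [&& injectiveb f, f @: [set: W]%SET == U
    & [forall x, forall y, adj F x y == adj H (f x) (f y)]].

Definition contains_copy (W V : finType) (F : graph W) (G : graph V) : bool :=
  [exists U : {set V}, exists H : graph V,
     is_subgraph U H G && [exists f : {ffun W -> V}, is_isomorphism F U H f]].

Definition free_graphs (W : finType) (F : graph W) (n : nat) :
    {set {set edge 'I_n}} :=
  [set G : {set edge 'I_n} | ~~ contains_copy F G]%SET.

Section WellDefined.
Context {R : realType} {X : finType}.
Implicit Types (p : R) (S A B : {set X}) (F G : {set {set X}}).

Lemma mu_set_prod p S :
  mu_set p S = \prod_(i : X) (if i \in S then p else 1 - p).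
Proof.
rewrite /mu_set (bigID (mem S)) /=; congr (_ * _).
  by rewrite (eq_bigr (fun=> p)) ?prodr_const// => i ->.
rewrite (eq_bigr (fun=> 1 - p)) => [|i /negPf->//].
rewrite -prodr_const; apply: eq_bigl => i; by rewrite inE.
Qed.

Lemma mu_set_ge0 p S : 0 <= p <= 1 -> 0 <= mu_set p S.
Proof.
by move=> /andP[p0 p1]; rewrite mulr_ge0// exprn_ge0// subr_ge0.
Qed.

Lemma mu_strict_decreasing F p p' : down_set F ->
    finset.set0 \in F -> [set: X]%SET \notin F ->
  0 <= p -> p < p' -> p' <= 1 -> mu p' F < mu p F.
Proof.
move=> /forall_inP dF F0 FT p0 pp' p'1.
have p'0 : 0 < p' by exact: le_lt_trans pp'.
have p'01 : 0 <= p' <= 1 by rewrite (ltW p'0).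
pose r := p / p'.
have r0 : 0 <= r by rewrite divr_ge0// ltW.
have r1 : r < 1 by rewrite ltr_pdivrMr// mul1r.
have p'r : p' * r = p by rewrite mulrC divfK// gt_eqF.
pose K (S T : {set X}) : R := \prod_i
  (if i \in S then if i \in T then r else 1 - r
   else if i \in T then 0 else 1).
have distr (f g : X -> R) :
    \sum_(T : {set X}) \prod_i (if i \in T then f i else g i) =
    \prod_i (f i + g i).
  by rewrite bigA_distr; apply: eq_bigl.
have K0 S T : 0 <= K S T.
  apply: prodr_ge0 => i _.
  by case: ifP => _; case: ifP => _//; rewrite subr_ge0 ltW.
have K1 S : \sum_(T : {set X}) K S T = 1.
  have KK T : K S T = \prod_i (if i \in T then (if i \in S then r else 0)
                                else (if i \in S then 1 - r else 1)).
    by apply: eq_bigr => i _; case: (i \in S); case: (i \in T).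
  under eq_bigr => T _ do rewrite KK.
  rewrite distr big1// => i _.
  by case: ifP => _; rewrite ?add0r// addrC subrK.
have Ksub (S T : {set X}) : ~~ (T \subset S) -> K S T = 0.
  move=> /subsetPn[i iT iS]; rewrite /K (bigD1 i)//= iT (negPf iS).
  by rewrite mul0r.
have KE (T : {set X}) : mu_set p T = \sum_(S : {set X}) mu_set p' S * K S T.
  have KK S : mu_set p' S * K S T = \prod_i
     (if i \in S then p' * (if i \in T then r else 1 - r)
      else (1 - p') * (if i \in T then 0 else 1)).
    rewrite mu_set_prod /K -big_split/=; apply: eq_bigr => i _.
    by case: (i \in S).
  under eq_bigr => S _ do rewrite KK.
  rewrite distr mu_set_prod; apply: eq_bigr => i _.
  case: ifP => _; first by rewrite p'r mulr0 addr0.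
  by rewrite mulrBr p'r !mulr1 [RHS]addrC subrKA.
rewrite {2}/mu; under eq_bigr => T _ do rewrite KE.
rewrite exchange_big/=.
under eq_bigr => S _ do rewrite -mulr_sumr.
rewrite (bigID (mem F))/= (bigD1 (P := fun i => i \notin F) [set: X]%SET)//=.
have -> : \sum_(S in F) mu_set p' S * (\sum_(T in F) K S T) = mu p' F.
  apply: eq_bigr => S SF; rewrite -[RHS]mulr1 -(K1 S); congr (_ * _).
  rewrite [RHS](bigID (mem F))/= [X in _ = _ + X]big1 ?addr0// => T TF.
  apply: Ksub; apply: contra TF => TS.
  by have /forallP/(_ T)/implyP/(_ TS) := dF _ SF.
rewrite ltrDl ltr_pwDl//; last first.
  apply: sumr_ge0 => S _; rewrite mulr_ge0 ?mu_set_ge0//.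
  exact: sumr_ge0.
rewrite mulr_gt0//.
  by rewrite /mu_set finset.setCT cards0 expr0 mulr1 exprn_gt0.
rewrite (bigD1 finset.set0)//= ltr_pwDl ?sumr_ge0//.
by rewrite prodr_gt0// => i _; rewrite !inE subr_gt0.
Qed.

Lemma mu0 F : finset.set0 \in F -> mu 0 F = 1 :> R.
Proof.
move=> F0; rewrite /mu (bigD1 finset.set0)//= big1 ?addr0 => [|S /andP[_ S0]].
  by rewrite /mu_set cards0 expr0 subr0 expr1n mulr1.
by rewrite /mu_set expr0n cards_eq0 (negPf S0) mul0r.
Qed.

Lemma mu1 F : [set: X]%SET \notin F -> mu 1 F = 0 :> R.
Proof.
move=> FT; rewrite /mu big1// => S SF.
rewrite /mu_set subrr expr0n cards_eq0 -finset.setCT (inj_eq (can_inj (@finset.setCK _))).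
by case: eqP SF FT => [->->//|]; rewrite mulr0.
Qed.

Lemma thresholdP F : down_set F ->
    finset.set0 \in F -> [set: X]%SET \notin F ->
  [/\ 0 <= (threshold F : R) <= 1, mu (threshold F : R) F = 1 / 2 &
    forall p, 0 <= p <= 1 -> mu p F = 1 / 2 -> p = threshold F].
Proof.
move=> dF F0 FT.
pose P : {poly R} := (1 / 2)%:P -
  \sum_(S in F) 'X ^+ #|S| * (1 - 'X) ^+ #|~: S|%SET.
have PE p : P.[p] = 1 / 2 - mu p F.
  rewrite !hornerE horner_sum; congr (_ - _); apply: eq_bigr => S _.
  by rewrite !hornerE /mu_set.
have [|p p01] := @poly_ivt R P 0 1 ler01.
  rewrite !PE mu0// mu1// subr0 subr_le0 divr_ge0//= andbT.
  by rewrite ler_pdivrMr// mul1r ler1n.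
rewrite rootE PE subr_eq0 => /eqP/esym mup.
have uniq (q q' : R) : 0 <= q <= 1 -> 0 <= q' <= 1 -> mu q F = 1 / 2 ->
    mu q' F = 1 / 2 -> q = q'.
  move=> /andP[q0 q1] /andP[q'0 q'1] e e'.
  have [qq'|qq'|//] := ltgtP q q'.
  - by have := mu_strict_decreasing dF F0 FT q0 qq' q'1; rewrite e e' ltxx.
  - by have := mu_strict_decreasing dF F0 FT q'0 qq' q1; rewrite e e' ltxx.
have [t01 tE] : [set p : R | 0 <= p <= 1 /\ mu p F = 1 / 2] (threshold F).
  by apply: xgetPex; exists p.
by split=> // q q01 qE; exact: uniq.
Qed.

Lemma smallestP (A : set R) p :
  A p -> lbound A p -> A (smallest A) /\ lbound A (smallest A).
Proof. by move=> Ap lp; exact: (xgetI 0 (P := A `&` lbound A) (x := p)). Qed.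

Lemma expectation_thresholdP F : [set: X]%SET \notin F ->
  expectation_feasible F (expectation_threshold F : R) /\
  lbound (expectation_feasible F) (expectation_threshold F : R).
Proof.
move=> FT.
pose c (G : {set {set X}}) (p : R) := \sum_(S in G) (1 - p) ^+ #|~: S|%SET.
pose D G := [set p : R | c G p <= 1 / 2].
have cD G : closed (D G).
  pose P : {poly R} := \sum_(S in G) (1 - 'X) ^+ #|~: S|%SET.
  rewrite (_ : D G = (horner P) @^-1` [set x | x <= 1 / 2]).
    by apply: preimage_closed; [move=> x _; exact: continuous_horner
      |exact: closed_le].
  apply/seteqP; have PE x : P.[x] = c G x.
    by rewrite horner_sum; apply: eq_bigr => S _; rewrite !hornerE.
  by split => x; rewrite /= PE.
pose E := [set G : {set {set X}} | F \subset down_closure G].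
have EE : expectation_feasible F = `[0, 1]%classic `&` \bigcup_(G in E) D G.
  apply/seteqP; split => [p [p01 [G [cG FG]]]|p /= [+ [G FG cG]]].
    by split; [rewrite /= in_itv|exists G].
  by rewrite in_itv/= => p01; split => //; exists G.
have cE : compact (expectation_feasible F : set R).
  rewrite EE; apply: compact_closedI; first exact: segment_compact.
  by apply: closed_bigcup => [|G _]; [exact: finite_finset|exact: cD].
have [|||p] := @compact_EVT_min R R id (expectation_feasible F).
- exists 1; split; first by rewrite ler01 lexx.
  exists F; split.
    rewrite big1 ?divr_ge0// => S SF; rewrite subrr expr0n cards_eq0.
    rewrite -finset.setCT (inj_eq (can_inj (@finset.setCK _))).
    by case: eqP SF FT => // ->->.
  apply/fintype.subsetP => S SF; apply/finset.bigcupP; exists S => //.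
  by rewrite powersetE.
- exact: cE.
- by apply: continuous_subspaceT => x; exact: cvg_id.
rewrite inE => pF pmin.
apply: (@smallestP _ p) => // q qF; apply: pmin; exact/mem_set.
Qed.

Lemma continuous_bigsum (T : topologicalType) (I : Type) (s : seq I)
    (Q : pred I) (f : I -> T -> R) :
  (forall i, continuous (f i)) -> continuous (fun v => \sum_(i <- s | Q i) f i v).
Proof.
move=> cf; elim: s => [|i s IH].
  rewrite (_ : (fun v => _) = cst 0); first exact: cst_continuous.
  by apply/funext => v; rewrite big_nil.
rewrite (_ : (fun v => _) = fun v : T =>
    (if Q i then f i v else 0) + \sum_(j <- s | Q j) f j v); last first.
  by apply/funext => v; rewrite big_cons; case: (Q i) => //; rewrite add0r.
move=> v; apply: cvgD; last exact: IH.
by case: (Q i); [exact: cf|exact: cvg_cst].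
Qed.

Lemma continuous_cost (T : topologicalType) (l : {set X} -> T -> R) (g : T -> R) :
  (forall S, continuous (l S)) -> continuous g ->
  continuous (fun v => \sum_S l S v * (1 - g v) ^+ #|~: S|%SET).
Proof.
move=> cl cg; apply: continuous_bigsum => S v; apply: cvgM; first exact: cl.
apply: (@continuous_comp _ _ _ (fun v => 1 - g v)
  (fun x : R => x ^+ #|~: S|%SET)); last exact: exprn_continuous.
by apply: cvgB; [exact: cvg_cst|exact: cg].
Qed.

Lemma fractional_expectation_thresholdP F : [set: X]%SET \notin F ->
  fractional_feasible F (fractional_expectation_threshold F : R) /\
  lbound (fractional_feasible F) (fractional_expectation_threshold F : R).
Proof.
move=> FT.
pose I : eqType := option {set X}.
pose T := prod_topology (fun _ : I => (R : topologicalType)).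
have coord (i : I) : continuous (fun v : T => v i).
  exact: (@proj_continuous I (fun=> R) i).
pose w (v : T) := \sum_S v (Some S) * (1 - v None) ^+ #|~: S|%SET.
have cw : continuous w.
  exact: (continuous_cost (T := T) (fun S => coord (Some S)) (coord None)).
pose u A (v : T) := \sum_(S : {set X} | A \subset S) v (Some S).
have cu A : continuous (u A).
  refine (@continuous_bigsum T {set X} _ (fun S => A \subset S)
    (fun S (v : T) => v (Some S)) _) => S.
  exact: coord.
pose D := [set v : T | forall i, 0 <= v i <= 1] `&`
  ([set v | w v <= 1 / 2] `&` \bigcap_(A in [set A | A \in F]) [set v | 1 <= u A v]).
have cD : compact D.
  apply: compact_closedI.
    apply: (@tychonoff I (fun=> R) (fun=> [set x : R | 0 <= x <= 1])) => _.
    rewrite (_ : mkset _ = `[0, 1]%classic); first exact: segment_compact.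
    by apply/seteqP; split => x; rewrite /= in_itv.
  apply: closedI.
    by apply: (@preimage_closed _ _ w [set x | x <= 1 / 2]);
      [move=> x _; exact: cw|exact: closed_le].
  apply: closed_bigI => A _.
  by apply: (@preimage_closed _ _ (u A) [set x | 1 <= x]);
    [move=> x _; exact: cu|exact: closed_ge].
have DF v : D v -> fractional_feasible F (v None).
  move=> [v01 [wv uv]]; split; first exact: v01.
  exists (fun S => v (Some S)); split => //.
  by move=> S; have /andP[] := v01 (Some S).
have FD p : fractional_feasible F p -> exists2 v, D v & v None = p.
  move=> [p01 [l [l0 lw lF]]].
  exists (fun i => if i is Some B then Num.min (l B) 1 else p) => //.
  split; first by case=> [S|]//=; rewrite le_min l0 ler01 ge_min lexx orbT.
  split.
    apply: le_trans lw; apply: ler_sum => S _; apply: ler_wpM2r.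
      by rewrite exprn_ge0// subr_ge0; case/andP: p01.
    by rewrite ge_min lexx.
  move=> A /= AF; rewrite /u.
  have [[S AS lS]|noS] := pselect (exists2 S : {set X}, A \subset S & 1 <= l S).
    rewrite (bigD1 S)//= (min_idPr lS) lerDl sumr_ge0// => B _.
    by rewrite le_min l0 ler01.
  apply: le_trans (lF A AF) _; apply: ler_sum => S AS.
  rewrite le_min lexx /= leNgt; apply/negP => /ltW lS.
  by apply: noS; exists S.
have [|||v] := @compact_EVT_min T R (fun v => v None) D.
- have [|v Dv _] := FD 1; last by exists v.
  split; first by rewrite ler01 lexx.
  exists (fun S => if S \in F then 1 else 0); split.
  + by move=> S; case: ifP.
  + rewrite big1 ?divr_ge0// => S _; case: ifP => [SF|_]; last by rewrite mul0r.
    rewrite mul1r subrr expr0n cards_eq0.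
    rewrite -finset.setCT (inj_eq (can_inj (@finset.setCK _))).
    by case: eqP SF FT => // ->->.
  + move=> A AF; rewrite (bigD1 A)//= AF lerDl sumr_ge0// => S _.
    by case: ifP.
- exact: cD.
- by apply: continuous_subspaceT => x; exact: coord.
rewrite inE => Dv vmin.
apply: (@smallestP _ (v None)); first exact: DF.
move=> q /FD[v' Dv' <-]; apply: vmin; exact/mem_set.
Qed.

End WellDefined.

Section FreeGraphs.
Context {W : finType}.
Implicit Types (F : graph W).

Lemma adjS (V : finType) (G H : graph V) x y :
  G \subset H -> adj G x y -> adj H x y.
Proof.
move=> /fintype.subsetP GH /exists_inP[a aG e]; apply/exists_inP.
by exists a => //; exact: GH.
Qed.

Lemma contains_copyP (V : finType) F (G : graph V) :
  reflect (exists2 f : W -> V, injective f &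
             forall x y, adj F x y -> adj G (f x) (f y))
          (contains_copy F G).
Proof.
apply: (iffP existsP) => [[U /existsP[H /andP[/andP[HG _] /existsP[f]]]]|].
  move=> /and3P[/injectiveP fi _ /forallP fF]; exists f => // x y xy.
  by apply: adjS HG _; have /forallP/(_ y)/eqP <- := fF x.
move=> [f fi fF]; exists (f @: [set: W])%SET.
pose H : graph V := [set a in G | [exists x, exists y,
  adj F x y && (val a == [set f x; f y]%SET)]]%SET.
apply/existsP; exists H; apply/andP; split.
  apply/andP; split; first by apply/fintype.subsetP => a; rewrite inE => /andP[].
  apply/forall_inP => a; rewrite inE => /andP[_ /existsP[x /existsP[y]]].
  move=> /andP[_ /eqP->]; apply/fintype.subsetP => z; rewrite !inE.
  by case/orP => /eqP ->; exact: imset_f.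
apply/existsP; exists [ffun x => f x]; apply/and3P; split.
- by apply/injectiveP => x y; rewrite !ffunE => /fi.
- by apply/eqP/eq_imset => x; rewrite ffunE.
apply/forallP => x; apply/forallP => y; rewrite !ffunE.
apply/eqP; apply/idP/idP.
  move=> xy; have /exists_inP[a aG e] := fF _ _ xy.
  apply/exists_inP; exists a => //; rewrite inE aG/=.
  by apply/existsP; exists x; apply/existsP; exists y; rewrite xy.
move=> /exists_inP[a]; rewrite inE => /andP[_ /existsP[x' /existsP[y']]].
move=> /andP[/exists_inP[b bF /eqP be] /eqP->] /eqP e.
apply/exists_inP; exists b => //; rewrite be; apply/eqP.
by apply: (imset_inj fi); rewrite !imsetU1 !imset_set1.
Qed.

Lemma free_graphs_down_set F n : down_set (free_graphs F n).
Proof.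
apply/forall_inP => A; rewrite inE => AF; apply/forallP => B; apply/implyP => BA.
rewrite inE; apply: contra AF => /contains_copyP[f fi fF].
by apply/contains_copyP; exists f => // x y /fF; exact: adjS.
Qed.

(* By the next two lemmas, [free_graphs F n] is neither empty nor full as soon
   as n >= #|W|, so that its thresholds are well defined. *)
Lemma set0_free_graphs F n :
  (2 <= max_degree F)%N -> finset.set0 \in free_graphs F n.
Proof.
move=> F2; rewrite inE; apply/negP => /contains_copyP[f fi fF].
move: F2; rewrite leqNgt => /negP; apply; rewrite ltnS leqW//.
apply/bigmax_leqP => x _; rewrite leqn0 cards_eq0 -finset.subset0.
apply/fintype.subsetP => y; rewrite inE => /fF/exists_inP[a].
by rewrite inE.
Qed.

Lemma setT_free_graphs F n :
  (#|W| <= n)%N -> [set: edge 'I_n]%SET \notin free_graphs F n.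
Proof.
move=> Wn; rewrite inE negbK; apply/contains_copyP.
pose f (x : W) : 'I_n := widen_ord Wn (enum_rank x).
have fi : injective f by move=> x y /(congr1 val)/= /val_inj/enum_rank_inj.
exists f => // x y /exists_inP[b _ /eqP be].
have xy : x != y.
  by apply/negP => /eqP e; have := valP b; rewrite be e finset.setUid cards1.
have fxy : #|[set f x; f y]%SET| == 2%N by rewrite cards2 (inj_eq fi) xy.
apply/exists_inP; exists (exist _ [set f x; f y]%SET fxy : edge 'I_n) => //.
Qed.

End FreeGraphs.

(* Main.v *)
Require Import Defs.
From mathcomp Require Import all_boot all_order all_algebra.
From mathcomp Require Import all_classical all_reals all_analysis.
From mathcomp Require Import ring lra zify.
Import Order.TTheory GRing.Theory Num.Theory.
Local Open Scope ring_scope.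

Set Implicit Arguments.
Unset Strict Implicit.
Unset Printing Implicit Defensive.

(** A feasible [lambda] is refuted by a probability measure on F-free graphs that
    misses every set T of edges with probability at most (1 - q)^|T|.  Let J be a
    densest subgraph of F, with e edges and v vertices, and condition G(n, p) on
    containing no copy of J.  If a given edge b completes a copy of J with
    probability at most 1/2, then Harris' inequality shows that, conditionally on
    J-freeness and on missing any set of other edges, b is still present with
    probability at least p/2; exposing the edges of T one by one gives the bound
    with q = p/2.  This works for p of order n^(-(v-2)/(e-1)), so both expectation
    thresholds are at least of that order.  A second moment computation bounds the
    threshold by O(n^(-v/e)), and (v-2)/(e-1) < v/e because 2v <= 3e for the
    densest J when F has a vertex of degree two. *)

(** * Random subsets of a finite set *)

Section RandomSubset.
Context {R : realType} {X : finType}.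
Implicit Types (p : R) (S K G : {set X}) (f g : {set X} -> R).

(* The expectation of f at a random subset of S containing each element
   independently with probability p. *)
Definition expect p S f : R :=
  \sum_(G : {set X} | G \subset S) p ^+ #|G| * (1 - p) ^+ #|S :\: G|%SET * f G.

Lemma expect_set0 p f : expect p finset.set0 f = f finset.set0.
Proof.
rewrite /expect (big_pred1 finset.set0) => [|G]; last by rewrite /= finset.subset0.
by rewrite finset.set0D cards0 !expr0 !mul1r.
Qed.

(** Conditioning on whether [b] is chosen: the recursion behind the inductions on [S]. *)
Lemma expect_setU1 p S b f : b \notin S ->
  expect p (b |: S)%SET f =
  p * expect p S (fun G => f (b |: G)%SET) + (1 - p) * expect p S f.
Proof.
move=> bS; rewrite /expect (bigID (fun G => b \in G))/= !mulr_sumr; congr (_ + _).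
  rewrite (reindex_onto (fun G => b |: G)%SET (fun G => G :\ b)%SET)/=; last first.
    by move=> G /andP[_ bG]; rewrite finset.setD1K.
  apply: eq_big => [G|G /andP[/andP[GS _] /eqP e]].
    rewrite finset.setU11 andbT; apply/andP/idP => [[GS /eqP <-]|GS].
      by rewrite finset.subDset.
    rewrite finset.setUS//; split=> //; apply/eqP/finset.setU1K.
    by apply: contra bS; exact: (fintype.subsetP GS).
  have bG : b \notin G by rewrite -e finset.setD11.
  rewrite cardsU1 bG exprS !mulrA; congr (_ * _ ^+ _ * _).
  congr #|pred_of_set _|; apply/finset.setP => x; rewrite !inE.
  by have [->|] := eqVneq x b; rewrite ?(negPf bS) ?andbF.
apply: eq_big => [G|G /andP[GS bG]].
  apply/andP/idP => [[GS bG]|GS]; last first.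
    split; first by apply: fintype.subset_trans GS _; exact: finset.subsetU1.
    by apply: contra bS; exact: (fintype.subsetP GS).
  apply/fintype.subsetP => x xG; have := fintype.subsetP GS x xG.
  by rewrite !inE; case/orP => // /eqP xb; rewrite xb (negPf bG) in xG.
have -> : ((b |: S) :\: G = b |: (S :\: G))%SET.
  by apply/finset.setP => x; rewrite !inE; case: eqP => // ->; rewrite bG.
rewrite cardsU1 !inE (negPf bS) andbF exprS.
ring.
Qed.

Lemma set_ind_setU1 (P : {set X} -> Prop) : P finset.set0 ->
  (forall b S, b \notin S -> P S -> P (b |: S)%SET) -> forall S, P S.
Proof.
move=> P0 PU S; move: {2}#|S| (erefl #|S|) => k.
elim: k S => [S /eqP|k IH S Sk]; first by rewrite cards_eq0 => /eqP ->.
have /set0Pn[b bS] : S != finset.set0 by rewrite -card_gt0 Sk.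
rewrite -(finset.setD1K bS); apply: PU; first by rewrite finset.setD11.
by apply: IH; move: Sk; rewrite (cardsD1 b) bS => -[].
Qed.

Lemma expectD p S f g :
  expect p S (fun G => f G + g G) = expect p S f + expect p S g.
Proof. by rewrite /expect -big_split; apply: eq_bigr => G _; rewrite mulrDr. Qed.

Lemma expectZ p S (c : R) f : expect p S (fun G => c * f G) = c * expect p S f.
Proof. by rewrite /expect mulr_sumr; apply: eq_bigr => G _; rewrite mulrCA. Qed.

Lemma expect_sum p S (I : Type) (r : seq I) (Q : pred I) (F : I -> {set X} -> R) :
  expect p S (fun G => \sum_(i <- r | Q i) F i G) =
  \sum_(i <- r | Q i) expect p S (F i).
Proof. by rewrite /expect exchange_big; apply: eq_bigr => G _; rewrite mulr_sumr. Qed.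

Lemma expect_cst p S (c : R) : expect p S (fun=> c) = c.
Proof.
elim/set_ind_setU1: S => [|b S bS IH]; first by rewrite expect_set0.
by rewrite expect_setU1// IH; ring.
Qed.

Lemma eq_expect p S f g : (forall G, G \subset S -> f G = g G) ->
  expect p S f = expect p S g.
Proof. by move=> fg; apply: eq_bigr => G GS; rewrite fg. Qed.

Lemma expect_le p S f g : 0 <= p <= 1 -> (forall G, f G <= g G) ->
  expect p S f <= expect p S g.
Proof.
move=> /andP[p0 p1] fg; apply: ler_sum => G _; apply: ler_wpM2l => //.
by rewrite mulr_ge0 ?exprn_ge0 ?subr_ge0.
Qed.

Lemma expect_ge0 p S f : 0 <= p <= 1 -> (forall G, 0 <= f G) -> 0 <= expect p S f.
Proof. by move=> p01 f0; rewrite -(expect_cst p S 0); exact: expect_le. Qed.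

Lemma expect_subset p S K :
  expect p S (fun G => (K \subset G)%:R) = if K \subset S then p ^+ #|K| else 0.
Proof.
elim/set_ind_setU1: S K => [|b S bS IH] K.
  by rewrite expect_set0 finset.subset0; case: eqP => // ->; rewrite cards0 expr0.
rewrite expect_setU1//.
rewrite (@eq_expect _ _ _ (fun G => (K :\ b \subset G)%SET%:R)); last first.
  by move=> G _; rewrite finset.subDset.
rewrite !IH finset.subDset; case: ifPn => KS.
  have [bK|bK] := boolP (b \in K).
    rewrite ifF; last by apply/negP => /fintype.subsetP/(_ b bK); exact/negP.
    by rewrite mulr0 addr0 (cardsD1 b K) bK exprS.
  have -> : (K :\ b = K)%SET by apply/finset.setDidPl; rewrite disjoint_sym disjoints1.
  rewrite ifT; first ring.
  apply/fintype.subsetP => x xK; have := fintype.subsetP KS x xK.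
  by rewrite !inE => /orP[/eqP xb|//]; rewrite -xb xK in bK.
rewrite ifF ?mulr0 ?addr0//; apply/negP => KS'; move/negP: KS; apply.
by apply: fintype.subset_trans KS' _; exact: finset.subsetU1.
Qed.

(** * Correlation of decreasing functions *)

Definition decreasing f := forall G G' : {set X}, G \subset G' -> f G' <= f G.

(* The induction step is Chebyshev's inequality for the two values of the
   indicator of [b]: the difference of both sides is the covariance term
   p (1 - p) (f1 - f0) (g1 - g0). *)
Lemma harris p S f g : 0 <= p <= 1 -> decreasing f -> decreasing g ->
  expect p S f * expect p S g <= expect p S (fun G => f G * g G).
Proof.
move=> /[dup] p01 /andP[p0 p1].
elim/set_ind_setU1: S f g => [|b S bS IH] f g df dg; first by rewrite !expect_set0.
have dU h : decreasing h -> decreasing (fun G => h (b |: G)%SET).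
  by move=> dh G G' GG'; apply: dh; exact: finset.setUS.
have le1 h : decreasing h -> expect p S (fun G => h (b |: G)%SET) <= expect p S h.
  by move=> dh; apply: expect_le => // G; apply: dh; exact: finset.subsetU1.
rewrite !expect_setU1//.
have := IH _ _ df dg; have := IH _ _ (dU _ df) (dU _ dg).
have := le1 _ df; have := le1 _ dg.
move: (expect p S f) (expect p S g) (expect p S (fun G => f (b |: G)%SET)).
move: (expect p S (fun G => g (b |: G)%SET)).
move: (expect p S (fun G => f G * g G)).
move: (expect p S (fun G => f (b |: G)%SET * g (b |: G)%SET)).
move=> h1 h0 g1 f0 g0 f1 gg ff h1P h0P.
have q0 : 0 <= 1 - p by rewrite subr_ge0.
apply: (@le_trans _ _ (p * (f1 * g1) + (1 - p) * (f0 * g0))); last first.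
  by rewrite lerD// ler_wpM2l.
rewrite -subr_ge0.
have -> : p * (f1 * g1) + (1 - p) * (f0 * g0) -
   (p * f1 + (1 - p) * f0) * (p * g1 + (1 - p) * g0) =
   (p * (1 - p)) * ((f0 - f1) * (g0 - g1)) by ring.
by rewrite !mulr_ge0// subr_ge0.
Qed.

(** Being inside [S] means missing its complement, which has probability [(1 - p) ^+ #|~: S|] and is
    independent of the choices within [S]. *)
Lemma sum_mu_set_subset p S (D : {set {set X}}) :
  \sum_(G in D | G \subset S) mu_set p G =
  (1 - p) ^+ #|~: S|%SET * expect p S (fun G => (G \in D)%:R).
Proof.
rewrite /expect mulr_sumr big_mkcondl; apply: eq_bigr => G GS.
case: ifP => _; last by rewrite !mulr0.
rewrite mulr1 mulrCA -exprD; congr (_ * _ ^+ _).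
rewrite -cardsUI [X in (_ + X)%N](_ : _ = 0)%N ?addn0; last first.
  apply/eqP; rewrite cards_eq0; apply/eqP/finset.setP => x; rewrite !inE.
  by case: (x \in S); rewrite ?andbF.
congr #|pred_of_set _|; apply/finset.setP => x; rewrite !inE.
have [/(fintype.subsetP GS) ->//|_] := boolP (x \in G).
by case: (x \in S).
Qed.

Lemma muE p (D : {set {set X}}) :
  mu p D = expect p [set: X]%SET (fun G => (G \in D)%:R).
Proof.
have := sum_mu_set_subset p [set: X]%SET D.
rewrite finset.setCT cards0 expr0 mul1r => <-.
by apply: eq_bigl => G; rewrite finset.subsetT andbT.
Qed.

(** With [KK] the copies of a graph, these are the graphs containing no copy of it. *)
Definition avoiding (KK : {set {set X}}) : {set {set X}} :=
  [set G : {set X} | [forall K in KK, ~~ (K \subset G)]]%SET.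

Lemma avoidingP (KK : {set {set X}}) G :
  reflect (forall K, K \in KK -> ~~ (K \subset G)) (G \in avoiding KK).
Proof. by rewrite inE; exact: forall_inP. Qed.

Lemma decreasing_avoiding KK : decreasing (fun G => (G \in avoiding KK)%:R).
Proof.
move=> G G' GG'; have [/avoidingP G'K|//] := boolP (G' \in avoiding KK).
rewrite ler_nat lt0b; apply/avoidingP => K /G'K; apply: contra => KG.
exact: fintype.subset_trans GG'.
Qed.

(** * Conditioning on avoiding a sparse family *)

Section SparseFamily.
Context (p : R) (KK : {set {set X}}) (p01 : 0 <= p <= 1)
  (sparse : forall b, \sum_(K in KK | b \in K) p ^+ #|K|.-1 <= 1 / 2).

Let phi S := expect p S (fun G => (G \in avoiding KK)%:R).

(* Given that G avoids KK, adding b keeps this property with conditional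
   probability at least 1/2: by Harris the condition only helps. *)
Lemma avoiding_setU1 S b : b \notin S -> (1 - p / 2) * phi S <= phi (b |: S)%SET.
Proof.
move=> bS; rewrite /phi expect_setU1//.
(* If [G] avoids [KK], adding [b] completes a member of [KK] exactly when [G] contains a member of
   [KKb]. *)
pose KKb := [set (K :\ b)%SET | K in [set K in KK | b \in K]%SET]%SET.
(* Union bound over [KKb], whose total is at most 1/2 by [sparse]. *)
have half : 1 / 2 <= expect p S (fun G => (G \in avoiding KKb)%:R).
  rewrite -[leLHS](_ : 1 - 1 / 2 = _); last by field.
  rewrite lerBlDr -lerBlDl -[X in X - _](expect_cst p S 1).
  apply: le_trans (sparse b).
  rewrite lerBlDr.
  apply: (@le_trans _ _ (\sum_(K in KK | b \in K)
      expect p S (fun G => (K :\ b \subset G)%SET%:R) +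
      expect p S (fun G => (G \in avoiding KKb)%:R))); last first.
    rewrite lerD2r; apply: ler_sum => K /andP[_ bK].
    rewrite expect_subset (cardsD1 b K) bK/=.
    by case: ifP => // _; rewrite exprn_ge0//; case/andP: p01.
  rewrite -expect_sum -expectD; apply: expect_le => // G.
  have [_|] := boolP (G \in avoiding KKb); first by rewrite lerDr sumr_ge0.
  rewrite inE negb_forall_in => /exists_inP[T /imsetP[K]].
  rewrite inE => /andP[KK1 bK] ->; rewrite negbK => KG.
  by rewrite addr0 (bigD1 K) ?KK1//= KG lerDl sumr_ge0.
(* Avoiding [KK] and avoiding [KKb] are both decreasing events, so Harris' inequality multiplies
   their probabilities. *)
have step : (1 / 2) * phi S <=
    expect p S (fun G => ((b |: G)%SET \in avoiding KK)%:R).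
  rewrite mulrC.
  apply: le_trans (ler_wpM2l _ half) _; first exact: expect_ge0.
  apply: le_trans (harris _ _ _ _) _ => //; try exact: decreasing_avoiding.
  apply: expect_le => // G; rewrite -natrM mulnb.
  have [/andP[/avoidingP G1 /avoidingP G2]|//] := boolP (_ && _).
  rewrite ler_nat lt0b; apply/avoidingP => K KKK; apply/negP => KG.
  have [bK|bK] := boolP (b \in K).
    have KKbK : (K :\ b)%SET \in KKb by apply: imset_f; rewrite inE KKK.
    by apply: (negP (G2 _ KKbK)); rewrite finset.subDset.
  apply: (negP (G1 K KKK)); apply/fintype.subsetP => x xK.
  have := fintype.subsetP KG x xK; rewrite !inE => /orP[/eqP xb|//].
  by rewrite -xb xK in bK.
have /andP[p0 _] := p01.
have := ler_wpM2l p0 step; rewrite -/(phi S) => h.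
rewrite [leLHS](_ : _ = p * (1 / 2 * phi S) + (1 - p) * phi S); last by field.
by rewrite lerD2r.
Qed.

(** Iterate the one-element step over the elements of the complement of [S]. *)
Lemma avoiding_setT S :
  (1 - p / 2) ^+ #|~: S|%SET * phi S <= phi [set: X]%SET.
Proof.
rewrite -(finset.setCK S); move: (~: S)%SET => T; rewrite finset.setCK.
elim/set_ind_setU1: T => [|b T bT IH].
  by rewrite cards0 expr0 mul1r finset.setC0.
apply: le_trans IH; rewrite cardsU1 bT exprSr -mulrA; apply: ler_wpM2l.
  by rewrite exprn_ge0//; case/andP: p01 => *; lra.
apply: le_trans (avoiding_setU1 (b := b) _) _; first by rewrite !inE eqxx.
rewrite le_eqVlt; apply/orP; left; apply/eqP; congr phi.
apply/finset.setP => x; rewrite !inE; case: eqP => //= ->; exact/esym.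
Qed.

(* The measure mu_p conditioned on [avoiding KK] misses a set T with probability
   at most (1 - p / 2) ^ |T|, so it is a dual certificate against lambda. *)
Lemma fractional_feasible_ge (F : {set {set X}}) p0 :
  finset.set0 \notin KK -> p < 1 ->
  avoiding KK \subset F -> fractional_feasible F p0 -> p / 2 <= p0.
Proof.
move=> K0 p1 DF [/andP[p00 p01'] [lambda [l0 lw lF]]].
rewrite leNgt; apply/negP => p0p.
have /andP[pge0 _] := p01.
pose D := avoiding KK.
have phi0 : 0 < phi [set: X]%SET.
  rewrite /phi -muE /mu (bigD1 finset.set0)/=; last first.
    by apply/avoidingP => K KKK; rewrite finset.subset0; apply: contraNneq K0 => <-.
  apply: ltr_pwDl; last by apply: sumr_ge0 => G _; exact: mu_set_ge0.
  by rewrite /mu_set cards0 expr0 mul1r exprn_gt0// subr_gt0.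
(* Averaging the covering inequality for [lambda] over [avoiding KK] and exchanging sums bounds the
   positive mass of [avoiding KK] by half of itself. *)
suff : phi [set: X]%SET <= phi [set: X]%SET / 2 by lra.
rewrite {1}/phi -muE /mu.
apply: (@le_trans _ _ (\sum_(G in D)
    mu_set p G * \sum_(S : {set X} | G \subset S) lambda S)).
  apply: ler_sum => G GD; rewrite ler_peMr ?mu_set_ge0//.
  by apply: lF; exact: (fintype.subsetP DF).
under eq_bigr => G _ do rewrite mulr_sumr.
rewrite (exchange_big_dep predT)//=.
apply: (@le_trans _ _ (\sum_(S : {set X}) phi [set: X]%SET *
    (lambda S * (1 - p0) ^+ #|~: S|%SET))); last first.
  by rewrite -mulr_sumr; apply: ler_wpM2l; [exact: ltW|lra].
apply: ler_sum => S _; rewrite -mulr_suml sum_mu_set_subset -/(phi S).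
rewrite mulrC [leRHS]mulrCA; apply: ler_wpM2l => //.
have q0 : 0 <= 1 - p / 2 by lra.
apply: le_trans (ler_wpM2r _ (avoiding_setT S)); last by rewrite exprn_ge0//; lra.
rewrite mulrAC -exprMn; apply: ler_wpM2r; first exact: expect_ge0.
(* Since [p0 < p / 2], the product [(1 - p / 2) * (1 - p0)] is at least [(1 - p / 2) ^+ 2], hence at
   least [1 - p]. *)
by apply: lerXn2r; rewrite ?nnegrE; nra.
Qed.

End SparseFamily.

(** Chebyshev's inequality for the number of [K i] inside the random set. The factor
    [p ^- #|K i :&: K j|] compares the probability of containing both sets with the independent
    case, so the last hypothesis bounds the variance by half the squared mean. *)
Lemma second_moment (I : finType) (Q : pred I) (K : I -> {set X}) (k : nat) p
    (F : {set {set X}}) : 0 < p <= 1 -> (exists i, Q i) ->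
  (forall i, Q i -> #|K i| = k) ->
  (forall i G, Q i -> G \in F -> ~~ (K i \subset G)) ->
  (forall i, Q i ->
    \sum_(j | Q j) p ^- #|K i :&: K j|%SET <= 3 / 2 * #|Q|%:R) ->
  mu p F <= 1 / 2.
Proof.
move=> /andP[p0 p1] [i0 Qi0] Kk KF cor.
have p01 : 0 <= p <= 1 by rewrite (ltW p0).
pose N (G : {set X}) : R := \sum_(i | Q i) (K i \subset G)%:R.
pose m : R := #|Q|%:R * p ^+ k.
have Q0 : 0 < #|Q|%:R :> R by rewrite ltr0n; apply/card_gt0P; exists i0.
have m0 : 0 < m by rewrite mulr_gt0// exprn_gt0.
have EN : expect p [set: X]%SET N = m.
  rewrite expect_sum (eq_bigr (fun=> p ^+ k)) => [|i Qi].
    by rewrite sumr_const /m mulr_natl.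
  by rewrite expect_subset finset.subsetT Kk.
have EN2 : expect p [set: X]%SET (fun G => N G * N G) <= 3 / 2 * m ^+ 2.
  have -> : expect p [set: X]%SET (fun G => N G * N G) =
      \sum_(i | Q i) \sum_(j | Q j) p ^+ #|K i :|: K j|%SET.
    rewrite (@eq_expect _ _ _
      (fun G => \sum_(i | Q i) \sum_(j | Q j) (K i :|: K j \subset G)%SET%:R)).
      rewrite expect_sum; apply: eq_bigr => i _; rewrite expect_sum.
      by apply: eq_bigr => j _; rewrite expect_subset finset.subsetT.
    move=> G _; rewrite /N mulr_suml; apply: eq_bigr => i _.
    rewrite mulr_sumr; apply: eq_bigr => j _.
    by rewrite -natrM mulnb finset.subUset.
  apply: (@le_trans _ _ (\sum_(i | Q i) p ^+ (k + k) * (3 / 2 * #|Q|%:R))).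
    apply: ler_sum => i Qi; apply: le_trans (ler_wpM2l _ (cor i Qi)); last first.
      by rewrite exprn_ge0// ltW.
    rewrite mulr_sumr; apply: ler_sum => j Qj; rewrite le_eqVlt; apply/orP; left.
    rewrite eq_sym -[X in (X + _)%N](Kk i Qi) -(Kk j Qj) -cardsUI exprD.
    by rewrite mulfK// expf_neq0// gt_eqF.
  rewrite sumr_const -mulr_natl /m exprMn exprD -expr2.
  by rewrite le_eqVlt; apply/orP; left; apply/eqP; ring.
(* Chebyshev: N = 0 on F, so (N - m)^2 >= m^2 there. *)
have : m ^+ 2 * mu p F <= expect p [set: X]%SET (fun G => (N G - m) ^+ 2).
  rewrite muE -expectZ; apply: expect_le => // G.
  have [GF|_] := boolP (G \in F); last by rewrite mulr0 sqr_ge0.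
  rewrite /N big1 => [|i Qi]; first by rewrite sub0r sqrrN mulr1.
  by rewrite (negPf (KF i G Qi GF)).
rewrite (@eq_expect _ _ _
  (fun G => N G * N G + ((- (2 * m)) * N G + m ^+ 2))); last first.
  by move=> G _; ring.
rewrite expectD expectD expectZ expect_cst EN => h.
have m20 : 0 < m ^+ 2 by rewrite exprn_gt0.
rewrite -(ler_pM2l m20); apply: le_trans h _.
rewrite (_ : - (2 * m) * m + m ^+ 2 = - m ^+ 2); last by ring.
lra.
Qed.

End RandomSubset.

(** * Copies of a graph *)

(** Each factor [n - i] of the falling factorial is at least [n / 2], as [i < m <= n / 2]. *)
Lemma leq_expn_ffact n m : (m.*2 <= n -> n ^ m <= 2 ^ m * n ^_ m)%N.
Proof.
move=> mn; rewrite ffact_prod -{2}(card_ord m) -[in (n ^ m)%N](card_ord m).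
rewrite -!prod_nat_const -big_split/=; apply: leq_prod => i _.
rewrite mul2n -addnn -{1}(subnK (ltnW (leq_trans (ltn_ord i) (leq_trans _ mn)))).
  rewrite leq_add2l leq_subRL; last first.
    by rewrite (leq_trans (ltnW (ltn_ord i)))// (leq_trans _ mn)// -addnn leq_addr.
  by apply: leq_trans mn; rewrite -addnn leq_add// ltnW.
by rewrite -addnn leq_addr.
Qed.

Lemma card_pfamily_if (W T : finType) (x0 : T) (U A : {set W}) (C : {set T}) :
  A \subset U ->
  #|pfamily x0 (mem U) (fun x => [pred y | (x \in A) ==> (y \in C)])| =
  (#|C| ^ #|A| * #|T| ^ (#|U| - #|A|))%N.
Proof.
move=> AU; rewrite card_pfamily foldrE big_map big_enum/=.
rewrite (bigID (mem A))/=; congr (_ * _)%N.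
  rewrite -prod_nat_const; apply: eq_big => [x|x /andP[_ xA]]; last first.
    by apply: eq_card => y; rewrite -[LHS]/((x \in A) ==> (y \in C)) xA.
  by apply/andb_idl; exact: (fintype.subsetP AU).
rewrite -[in RHS](finset.setIidPr AU) -cardsD -prod_nat_const.
apply: eq_big => [x|x /andP[_ /negPf xA]]; first by rewrite !inE andbC.
by apply: eq_card => y; rewrite -[LHS]/((x \in A) ==> (y \in C)) xA.
Qed.

Section Copies.
Context {W V : finType}.
Implicit Types (J : graph W) (f g : W -> V).

(** Isolated vertices are left out, so a subgraph and its density are determined by its edge set. *)
Definition vsupp J : {set W} := (\bigcup_(a in J) val a)%SET.

(** An edge collapsed by [f] has an image of size one and drops out. *)
Definition emap f J : graph V :=
  [set b : edge V | [exists a in J, val b == f @: val a]]%SET.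

Lemma emapP f J (b : edge V) :
  reflect (exists2 a, a \in J & val b = (f @: val a)%SET) (b \in emap f J).
Proof.
by rewrite inE; apply: (iffP exists_inP) => -[a aJ /eqP]; exists a => //; apply/eqP.
Qed.

Lemma subset_vsupp J a : a \in J -> val a \subset vsupp J.
Proof. by move=> aJ; rewrite /vsupp (bigD1 a)//= finset.subsetUl. Qed.

Lemma imset_inj_on f (U A B : {set W}) : {in U &, injective f} ->
  A \subset U -> B \subset U -> (f @: A)%SET = (f @: B)%SET -> A = B.
Proof.
move=> fi; suff h : forall A' B' : {set W}, A' \subset U -> B' \subset U ->
    (f @: A')%SET = (f @: B')%SET -> A' \subset B'.
  by move=> AU BU e; apply/eqP; rewrite finset.eqEsubset; apply/andP; split; apply: h.
move=> A' B' AU BU e; apply/fintype.subsetP => x xA.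
have : f x \in (f @: B')%SET by rewrite -e imset_f.
move=> /imsetP[y yB] /fi -> //.
  exact: (fintype.subsetP AU).
exact: (fintype.subsetP BU).
Qed.

Lemma card_emap f J : {in vsupp J &, injective f} -> #|emap f J| = #|J|.
Proof.
move=> fi.
have <- : #|[set val b | b : edge V in emap f J]%SET| = #|emap f J|.
  exact/card_imset/val_inj.
have -> : [set val b | b : edge V in emap f J]%SET =
    [set f @: val a | a : edge W in J]%SET.
  apply/finset.setP => B; apply/imsetP/imsetP => [[b /emapP[a aJ ba] ->]|[a aJ ->]].
    by exists a.
  have cfa : #|(f @: val a)%SET| == 2%N.
    rewrite card_in_imset ?(valP a)// => x y xa ya.
    by apply: fi; exact: (fintype.subsetP (subset_vsupp aJ)).
  by exists (exist _ (f @: val a)%SET cfa : edge V) => //; apply/emapP; exists a.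
rewrite card_in_imset// => a a' aJ a'J e; apply: val_inj.
by apply: imset_inj_on fi _ _ e; exact: subset_vsupp.
Qed.

Lemma eq_in_emap f g J : {in vsupp J, f =1 g} -> emap f J = emap g J.
Proof.
move=> fg; apply/finset.setP => b.
apply/emapP/emapP => -[a aJ ->]; exists a => //; apply: eq_in_imset => x xa;
  [|symmetry]; by apply: fg; exact: (fintype.subsetP (subset_vsupp aJ)).
Qed.

(** A copy is an edge set, so embeddings with the same image count once. *)
Definition copies J : {set {set edge V}} :=
  [set emap (fun_of_fin f) J | f : {ffun W -> V} &
    [forall x in vsupp J, forall y in vsupp J, (f x == f y) ==> (x == y)]]%SET.

Lemma copiesP J K :
  reflect (exists2 f, {in vsupp J &, injective f} & K = emap f J) (K \in copies J).
Proof.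
apply: (iffP imsetP) => [[f]|[f fi ->]].
  rewrite inE => /forall_inP fi ->; exists f => // x y xJ yJ /eqP e.
  by have /forall_inP/(_ y yJ)/implyP/(_ e)/eqP := fi x xJ.
exists [ffun x => f x].
  rewrite inE; apply/forall_inP => x xJ; apply/forall_inP => y yJ.
  by rewrite !ffunE; apply/implyP => /eqP /fi ->.
by apply: eq_in_emap => x _; rewrite ffunE.
Qed.

(* A copy of J through b is determined by the edge a of J sent to b, the images
   of the two ends of a, and the images of the other vertices of J. *)
Lemma card_copies_edge J (b : edge V) :
  (#|[set K in copies J | b \in K]%SET| <= #|J| * (4 * #|V| ^ (#|vsupp J| - 2)))%N.
Proof.
have /set0Pn[x0 _] : val b != finset.set0 by rewrite -card_gt0 (eqP (valP b)).
(* Maps are normalised to [x0] outside [vsupp J], so each is counted by its values there. The two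
   ends of [a] go into [b] in [2 ^ 2] ways, whence the factor 4. *)
pose P (a : edge W) := pfamily x0 (mem (vsupp J))
  (fun x => [pred y | (x \in val a) ==> (y \in val b)]).
pose Z := [set u : edge W * {ffun W -> V} | (u.1 \in J) && (u.2 \in P u.1)]%SET.
have -> : (#|J| * (4 * #|V| ^ (#|vsupp J| - 2)) = #|Z|)%N.
  rewrite -[RHS]sum1_card (eq_bigl (fun u : edge W * {ffun W -> V} =>
    (u.1 \in J) && (u.2 \in P u.1))) => [|u]; last by rewrite inE.
  rewrite -(pair_big_dep (mem J) (fun a (g : {ffun W -> V}) => g \in P a)
    (fun _ _ => 1%N))/=.
  rewrite -sum_nat_const; apply: eq_bigr => a aJ.
  rewrite sum1_card card_pfamily_if ?subset_vsupp//.
  by rewrite (eqP (valP a)) (eqP (valP b)).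
apply: leq_trans (leq_imset_card (fun u : edge W * {ffun W -> V} => emap u.2 J) _).
apply/subset_leq_card/fintype.subsetP => K; rewrite inE => /andP[/copiesP[f fi ->]].
move=> /emapP[a aJ ba]; apply/imsetP.
exists (a, [ffun x => if x \in vsupp J then f x else x0]).
  rewrite inE aJ/=; apply/pfamilyP; split.
    by apply/fintype.subsetP => x; rewrite !inE ffunE; case: ifP => //; rewrite eqxx.
  move=> x xJ; rewrite ffunE xJ inE/=; apply/implyP => xa.
  by rewrite ba imset_f.
by apply: eq_in_emap => x xJ; rewrite ffunE xJ.
Qed.

Lemma adj_emap f J (G : graph V) x y : emap f J \subset G ->
  {in vsupp J &, injective f} -> adj J x y -> adj G (f x) (f y).
Proof.
move=> /fintype.subsetP fG fi /exists_inP[a aJ /eqP axy].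
have xy : x != y.
  by apply/negP => /eqP e; have := valP a; rewrite axy e finset.setUid cards1.
have aU := fintype.subsetP (subset_vsupp aJ).
have fxy : #|[set f x; f y]%SET| == 2%N.
  rewrite cards2 (_ : f x != f y)//; apply: contraNneq xy => /fi -> //.
    by apply: aU; rewrite axy !inE eqxx.
  by apply: aU; rewrite axy !inE eqxx orbT.
apply/exists_inP; exists (exist _ [set f x; f y]%SET fxy : edge V) => //.
apply: fG; apply/emapP; exists a => //=.
by rewrite axy imsetU1 imset_set1.
Qed.

Lemma emap_subset f J (G : graph V) :
  (forall x y, adj J x y -> adj G (f x) (f y)) -> emap f J \subset G.
Proof.
move=> h; apply/fintype.subsetP => b /emapP[a aJ ba].
have /cards2P[x [y [_ axy]]] := valP a.
have /exists_inP[c cG /eqP cfxy] : adj G (f x) (f y).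
  by apply: h; apply/exists_inP; exists a => //; rewrite axy.
rewrite (_ : b = c)//.
by apply: val_inj; rewrite cfxy ba axy imsetU1 imset_set1.
Qed.

(** Read as an image under [g], the overlap becomes a subgraph of [F], with boundedly many
    possibilities. *)
Lemma emap_setI f g (F : graph W) : injective f -> injective g ->
  (emap f F :&: emap g F)%SET =
  emap g [set a in F | (g @: val a)%SET \in [set val b | b : edge V in emap f F]%SET]%SET.
Proof.
move=> fi gi; apply/finset.setP => b; rewrite inE.
apply/andP/emapP => [[bf /emapP[a aF ba]]|[a]].
  by exists a => //; rewrite inE aF -ba imset_f.
rewrite inE => /andP[aF /imsetP[c cf gc]] ba.
have bc : b = c by apply: val_inj; rewrite ba.
by split; [rewrite bc|apply/emapP; exists a].
Qed.

End Copies.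

(** * Thresholds of the F-free graphs *)

Section FreeGraphThresholds.
Context {R : realType} {W : finType}.
Implicit Types (F J : graph W) (p : R) (n : nat).

(** The copies of [J] form a sparse family: few pass through a given edge, and each needs [#|J|.-1]
    further edges. A graph without a copy of [J] is also [F]-free. *)
Lemma fractional_free_graphs_ge F J n p p0 : J \subset F -> J != finset.set0 ->
  0 <= p < 1 ->
  (#|J| * (4 * n ^ (#|vsupp J| - 2)))%:R * p ^+ #|J|.-1 <= 1 / 2 ->
  fractional_feasible (free_graphs F n) p0 -> p / 2 <= p0.
Proof.
move=> JF J0 /andP[pge0 p1] small.
have cardK (K : graph 'I_n) : K \in copies J -> #|K| = #|J|.
  by move=> /copiesP[f fi ->]; exact: card_emap.
apply: (@fractional_feasible_ge _ _ p (copies J)) => //.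
- by rewrite pge0 ltW.
- move=> b; apply: le_trans small.
  rewrite (eq_bigr (fun=> p ^+ #|J|.-1)) => [|K /andP[KJ _]]; last by rewrite cardK.
  rewrite sumr_const -[leLHS]mulr_natl; apply: ler_wpM2r; first exact: exprn_ge0.
  have := card_copies_edge J b; rewrite card_ord ler_nat; apply: leq_trans.
  by apply: eq_leq; apply: eq_card => K; rewrite inE.
- apply/negP => /cardK/esym/eqP; rewrite cards0 cards_eq0.
  exact/negP.
apply/fintype.subsetP => G /avoidingP GJ; rewrite inE.
apply/negP => /contains_copyP[f fi fF].
have fiJ : {in vsupp J &, injective f} by move=> x y _ _; exact: fi.
have /negP := GJ _ (introT (copiesP J _) (ex_intro2 _ _ f fiJ erefl)); apply.
by apply: emap_subset => x y /(adjS JF); exact: fF.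
Qed.

(** Second moment over the embeddings of [F]. In the constant, [2 ^ #|F|] pays for the choice of
    [J], [2 ^ #|W|] for comparing [n ^ #|W|] with the number of injections, [#|W| ^ #|W|] for
    mapping [vsupp J] into a given copy, and the last 2 leaves overlapping pairs a share of 1/2. *)
Lemma mu_free_graphs_le F n p : 0 < p <= 1 -> (0 < n)%N -> (#|W|.*2 <= n)%N ->
  (forall J, J \subset F -> J != finset.set0 ->
    (2 ^ (#|F| + #|W|).+1 * #|W| ^ #|W|)%:R <= p ^+ #|J| * n%:R ^+ #|vsupp J|) ->
  mu p (free_graphs F n) <= 1 / 2.
Proof.
move=> p01 n0 wn big.
have /andP[p0 p1] := p01.
pose Q : pred {ffun W -> 'I_n} := fun f => injectiveb f.
have Qcard : #|Q| = (n ^_ #|W|)%N.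
  have := card_inj_ffuns W 'I_n; rewrite card_ord => <-.
  by apply: eq_card => f; rewrite inE.
apply: (@second_moment _ _ _ Q (fun f => emap f F) #|F|) => //.
- have : (0 < #|Q|)%N by rewrite Qcard ffact_gt0 (leq_trans _ wn)// -addnn leq_addr.
  by move=> /card_gt0P[f fQ]; exists f.
- by move=> f /injectiveP fi; apply: card_emap => x y _ _; exact: fi.
- move=> f G /injectiveP fi; rewrite inE; apply: contra => fG.
  apply/contains_copyP; exists f => // x y; apply: adj_emap fG _.
  by move=> x' y' _ _; exact: fi.
move=> f /injectiveP fi.
(* The intersection of the copies f(F) and g(F) is g(Jg g), and g maps the
   vertices of Jg g into the vertices of f(F): this bounds the number of g with
   a given Jg. *)
pose Jg (g : {ffun W -> 'I_n}) : graph W :=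
  [set a in F | (g @: val a)%SET \in [set val b | b : edge 'I_n in emap f F]%SET]%SET.
pose M J := [set g : {ffun W -> 'I_n} | [forall x in vsupp J, g x \in f @: [set: W]]]%SET.
have MJ g : g \in M (Jg g).
  rewrite inE; apply/forall_inP => x /finset.bigcupP[a]; rewrite inE.
  move=> /andP[aF /imsetP[c /emapP[a' a'F ->] ga]] xa.
  have : g x \in (g @: val a)%SET by exact: imset_f.
  by rewrite ga; apply: fintype.subsetP; apply: imsetS; exact: finset.subsetT.
have Mcard J : (#|M J| <= #|W| ^ #|W| * n ^ (#|W| - #|vsupp J|))%N.
  have y0 : 'I_n := Ordinal n0.
  have -> : #|M J| = #|pfamily y0 (mem [set: W]%SET)
      (fun x => [pred y | (x \in vsupp J) ==> (y \in f @: [set: W]%SET)])|.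
    apply: eq_card => g; rewrite inE; apply/forall_inP/pfamilyP => [gM|[_ gM] x xJ].
      split; first by apply/fintype.subsetP => x; rewrite inE.
      by move=> x _; rewrite inE/=; apply/implyP; exact: gM.
    by have := gM x (finset.in_setT x); rewrite inE/= xJ.
  rewrite card_pfamily_if ?finset.subsetT// card_imset// cardsT card_ord.
  rewrite leq_mul2r; apply/orP; right.
  have [W0|W0] := posnP #|W|; last by rewrite leq_pexp2l// max_card.
  have -> : #|vsupp J| = #|W| by apply/eqP; rewrite eqn_leq max_card W0.
  by [].
have term J : J \subset F -> J != finset.set0 ->
    p ^- #|J| * #|M J|%:R <= n%:R ^+ #|W| / 2 ^+ (#|F| + #|W|).+1.
  move=> JF J0; rewrite ler_pdivlMr ?exprn_gt0// mulrC mulrCA.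
  rewrite mulrC ler_pdivrMr ?exprn_gt0//.
  have := big J JF J0.
  rewrite natrM natrX => bigJ.
  apply: (@le_trans _ _ (2 ^+ (#|F| + #|W|).+1 *
     (#|W| ^ #|W| * n ^ (#|W| - #|vsupp J|))%:R)).
    by rewrite ler_wpM2l ?exprn_ge0// ler_nat.
  rewrite natrM mulrA; apply: le_trans (ler_wpM2r _ bigJ) _ => //.
  by rewrite natrX -mulrA -exprD subnKC ?max_card// mulrC.
(* A copy sharing no edge with that of [f] contributes 1; otherwise [Jg g] is nonempty and its term
   occurs in the inner sum. *)
apply: (@le_trans _ _ (\sum_(g | Q g) (1 +
    \sum_(J : graph W | (J \subset F) && (J != finset.set0))
      p ^- #|J| * (g \in M J)%:R))).
  apply: ler_sum => g /injectiveP gi.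
  rewrite emap_setI// card_emap; last by move=> x y _ _; exact: gi.
  rewrite -/(Jg g).
  have s0 (P : pred (graph W)) : 0 <= \sum_(J : graph W | P J) p ^- #|J| * (g \in M J)%:R.
    by apply: sumr_ge0 => J _; rewrite mulr_ge0// invr_ge0 exprn_ge0// ltW.
  have [->|J0] := eqVneq (Jg g) finset.set0.
    by rewrite cards0 expr0 invr1 lerDl s0.
  rewrite (bigD1 (Jg g))/=; last first.
    by rewrite J0 andbT; apply/fintype.subsetP => a; rewrite inE => /andP[].
  by rewrite MJ mulr1 addrCA lerDl addr_ge0// s0.
rewrite big_split/= sumr_const exchange_big/=.
apply: (@le_trans _ _ (#|Q|%:R + \sum_(J : graph W | (J \subset F) && (J != finset.set0))
    n%:R ^+ #|W| / 2 ^+ (#|F| + #|W|).+1)).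
  rewrite lerD2l; apply: ler_sum => J /andP[JF J0]; apply: le_trans (term J JF J0).
  rewrite -mulr_sumr ler_wpM2l ?invr_ge0 ?exprn_ge0 ?(ltW p0)//.
  rewrite -natr_sum ler_nat -sum1_card big_mkcond [leqRHS]big_mkcond/=.
  by apply: leq_sum => g _; case: (Q g) => //; case: (g \in M J).
have hp : (n%:R ^+ #|W| / 2 ^+ #|W| : R) <= #|Q|%:R.
  by rewrite ler_pdivrMr ?exprn_gt0// mulrC -!natrX -natrM ler_nat Qcard leq_expn_ffact.
suff : \sum_(J : graph W | (J \subset F) && (J != finset.set0))
    n%:R ^+ #|W| / 2 ^+ (#|F| + #|W|).+1 <= #|Q|%:R / 2 :> R by lra.
apply: (@le_trans _ _ (2 ^+ #|F| * (n%:R ^+ #|W| / 2 ^+ (#|F| + #|W|).+1))).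
  rewrite sumr_const -[leLHS]mulr_natl; apply: ler_wpM2r.
    by rewrite divr_ge0// exprn_ge0.
  rewrite -natrX ler_nat -card_powerset; apply/subset_leq_card/fintype.subsetP => J.
  by rewrite powersetE => /andP[].
have cancel2 (x y z : R) : x != 0 -> y != 0 -> x * (z / (2 * (x * y))) = z / y / 2.
  by move=> x0 y0; field; rewrite x0 y0.
rewrite exprS exprD cancel2 ?expf_neq0 ?pnatr_eq0//.
by rewrite ler_wpM2r.
Qed.

Lemma powR_root n k : (0 < k)%N -> (n%:R `^ (k%:R)^-1 : R) ^+ k = n%:R.
Proof.
by move=> k0; rewrite -powR_mulrn ?powR_ge0// -powRrM mulVf ?powRr1// pnatr_eq0 -lt0n.
Qed.

(** Take [J] maximising edges per vertex. Two edges at a common vertex have density at least 2/3, so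
    [J] does too. *)
Lemma dense_subgraph F : (2 <= max_degree F)%N ->
  exists J, [/\ J \subset F, J != finset.set0, (2 * #|vsupp J| <= 3 * #|J|)%N &
    forall J', J' \subset F -> J' != finset.set0 ->
      (#|J'| * #|vsupp J| <= #|J| * #|vsupp J'|)%N].
Proof.
move=> hF.
have vs J : J != finset.set0 -> (0 < #|vsupp J|)%N.
  move=> /set0Pn[a aJ]; apply: leq_trans (subset_leq_card (subset_vsupp aJ)).
  by rewrite (eqP (valP a)).
have [x] : exists x, (2 <= degree F x)%N.
  apply/existsP; apply: contraLR hF; rewrite negb_exists => /forallP h.
  rewrite -ltnNge ltnS; apply/bigmax_leqP => x _.
  by have := h x; rewrite -ltnNge.
move=> /card_gt1P[y [z [+ + yz]]]; rewrite !inE.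
move=> /exists_inP[a aF /eqP axy] /exists_inP[b bF /eqP bxz].
have ab : a != b.
  apply: contraNneq yz => ab; have : z \in val a by rewrite ab bxz !inE eqxx orbT.
  have := valP b; rewrite bxz axy !inE => xz.
  case/orP => /eqP zz; last by rewrite zz.
  by rewrite zz finset.setUid cards1 in xz.
pose P J := (J \subset F) && (J != finset.set0).
pose J0 : graph W := [set a; b]%SET.
have PJ0 : P J0.
  rewrite /P finset.subUset !finset.sub1set aF bF/=.
  by apply/set0Pn; exists a; rewrite !inE eqxx.
pose dens J : rat := #|J|%:R / #|vsupp J|%:R.
have [J /andP[JF JN0] Jmax] := arg_maxP dens PJ0.
have cross J1 J2 : P J1 -> P J2 -> dens J1 <= dens J2 ->
    (#|J1| * #|vsupp J2| <= #|J2| * #|vsupp J1|)%N.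
  move=> /andP[_ /vs J1v] /andP[_ /vs J2v].
  rewrite /dens ler_pdivrMr ?ltr0n// mulrAC ler_pdivlMr ?ltr0n//.
  by rewrite -!natrM ler_nat.
exists J; split=> //; last first.
  move=> J' J'F J'0; have PJ' : P J' by rewrite /P J'F.
  by apply: cross => //; [rewrite /P JF|exact: Jmax].
have := cross _ _ PJ0 (introT andP (conj JF JN0)) (Jmax _ PJ0).
have -> : #|J0| = 2%N by rewrite cards2 ab.
move=> /leq_trans; apply; rewrite mulnC leq_mul2r; apply/orP; right.
apply: (@leq_trans #|[set x; y; z]%SET|); last first.
  by apply: leq_trans (leq_card_setU _ _) _; rewrite cards2 cards1; case: (_ != _).
apply/subset_leq_card/finset.bigcupsP => c; rewrite !inE => /orP[] /eqP ->.
  by rewrite axy finset.subsetUl.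
by rewrite bxz; apply/fintype.subsetP => u; rewrite !inE => /orP[] ->; rewrite ?orbT.
Qed.

End FreeGraphThresholds.

(** The indicator of [G] is a fractional cover; hence a lower bound on fractionally feasible values
    serves both thresholds. *)
Lemma expectation_fractional_feasible (R : realType) (X : finType)
    (F : {set {set X}}) (p : R) :
  expectation_feasible F p -> fractional_feasible F p.
Proof.
move=> [p01 [G [cG FG]]]; split=> //; exists (fun S => (S \in G)%:R); split=> //.
  rewrite (eq_bigr (fun S => if S \in G then (1 - p) ^+ #|~: S|%SET else 0)).
    by rewrite -big_mkcond.
  by move=> S _; case: (S \in G); rewrite ?mul1r ?mul0r.
move=> A /(fintype.subsetP FG)/finset.bigcupP[S SG]; rewrite powersetE => AS.
by rewrite (bigD1 S)//= SG lerDl sumr_ge0.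
Qed.

(** As [mu] strictly decreases in [p], it exceeds 1/2 below the threshold. *)
Lemma threshold_free_graphs_le (R : realType) (W : finType) (F : graph W) n (p : R) :
  (2 <= max_degree F)%N -> (0 < n)%N -> (#|W|.*2 <= n)%N -> 0 < p ->
  (forall J : graph W, J \subset F -> J != finset.set0 ->
    (2 ^ (#|F| + #|W|).+1 * #|W| ^ #|W|)%:R <= p ^+ #|J| * n%:R ^+ #|vsupp J|) ->
  threshold (free_graphs F n) <= p.
Proof.
move=> hF n0 wn p0 big.
have Wn : (#|W| <= n)%N by rewrite (leq_trans _ wn)// -addnn leq_addr.
have dF := free_graphs_down_set F n; have F0 := set0_free_graphs n hF.
have FT := setT_free_graphs F Wn.
have [/andP[_ t1] tE _] := @thresholdP R _ _ dF F0 FT.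
rewrite leNgt; apply/negP => pt.
have := mu_strict_decreasing dF F0 FT (ltW p0) pt t1; rewrite tE ltNge.
by rewrite mu_free_graphs_le// p0 ltW// (lt_le_trans pt).
Qed.

Theorem theorem1 (R : realType) (W : finType) (F : graph W)
    (hF : (2 <= max_degree F)%N) :
  exists (gamma : R) (n0 : nat),
    [/\ 0 < gamma, (1 <= n0)%N &
      forall n : nat, (n0 <= n)%N ->
        expectation_threshold (free_graphs F n)
          >= n%:R `^ gamma * threshold (free_graphs F n) :> R /\
        fractional_expectation_threshold (free_graphs F n)
          >= n%:R `^ gamma * threshold (free_graphs F n) :> R].
Proof.
have [J [JF J0 Jdense Jmax]] := dense_subgraph hF.
have [e eE] : exists e, e = #|J| by exists #|J|.
have [v vE] : exists v, v = #|vsupp J| by exists #|vsupp J|.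
have /set0Pn[a aJ] := J0.
have v2 : (2 <= v)%N.
  by rewrite vE -(eqP (valP a)); exact: subset_leq_card (subset_vsupp aJ).
have W0 : (0 < #|W|)%N by apply: leq_trans (max_card (mem (vsupp J))); rewrite -vE ltnW.
rewrite -eE -vE in Jdense Jmax.
have e2 : (2 <= e)%N by lia.
(* With z = n^(1/k) and k = 2e(e-1), n^(-v/e) and n^(-(v-2)/(e-1)) become
   z^(-2v(e-1)) and z^(-2e(v-2)); the exponents differ by 2(2e-v) >= 2. *)
have ex : (2 * v * e.-1 = 2 * e * (v - 2) + (2 + (2 * (2 * e - v)).-2))%N.
  by clear -Jdense e2 v2; nia.
pose k := (2 * e * e.-1)%N.
have k0 : (0 < k)%N by rewrite /k; nia.
pose B := (2 ^ (#|F| + #|W|).+1 * #|W| ^ #|W|)%N.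
have B0 : (0 < B)%N by rewrite muln_gt0 !expn_gt0 W0.
(* The ratio of the constants in [p1] and [p2 / 2] below. *)
pose c := (16 * e * B)%N.
have c0 : (0 < c)%N by rewrite /c; nia.
(* Of the two spare powers of [z], one is [n ^ gamma] and the other absorbs [c], since [n >= c ^ k]
   gives [z >= c]. *)
exists (k%:R)^-1, (maxn #|W|.*2 (c ^ k)).
split; first by rewrite invr_gt0 ltr0n.
  by rewrite leq_max expn_gt0 c0 orbT.
move=> n; rewrite geq_max => /andP[wn cn].
have n0 : (0 < n)%N by apply: leq_trans cn; rewrite expn_gt0 c0.
have Wn : (#|W| <= n)%N by rewrite (leq_trans _ wn)// -addnn leq_addr.
have zk := @powR_root R n k k0.
set z : R := n%:R `^ _ in zk *.
have zge0 : 0 <= z by exact: powR_ge0.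
have cz : c%:R <= z.
  by rewrite -(@ler_pXn2r _ k)// ?nnegrE// zk -natrX ler_nat.
have z1 : 1 <= z by apply: le_trans cz; rewrite ler1n.
have z0 : 0 < z by exact: lt_le_trans z1.
have z1n m : 1 <= z ^+ m by exact: exprn_ege1.
have zn0 m : 0 < z ^+ m by rewrite exprn_gt0.
have B1 : 1 <= B%:R :> R by rewrite ler1n.
have e1 : 1 <= e%:R :> R by rewrite ler1n ltnW.
have e0 : 0 < e%:R :> R by exact: lt_le_trans e1.
have BR0 : 0 < B%:R :> R by rewrite ltr0n.
pose p1 : R := B%:R / z ^+ (2 * v * e.-1).
(* The factor [8 * e] makes [4 * e * n ^ (v - 2) * p2 ^ (e - 1)] at most 1/2, using [e >= 2]. *)
pose p2 : R := (8 * e%:R * z ^+ (2 * e * (v - 2)))^-1.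
have upper : threshold (free_graphs F n) <= p1.
  apply: threshold_free_graphs_le => //; first by rewrite divr_gt0.
  (* Maximal density of [J] makes the power of [n] outweigh that of [z] in the denominator, leaving
     at least [B]. *)
  move=> J' J'F J'0; have J'v := Jmax _ J'F J'0.
  rewrite -/B -zk -exprM /p1 expr_div_n -exprM mulrAC ler_pdivlMr//.
  apply: ler_pM => //; first exact: exprn_ge0.
    rewrite -[leLHS]expr1; apply: ler_weXn2l => //.
    by rewrite card_gt0.
  apply: ler_weXn2l => //.
  rewrite (_ : 2 * v * e.-1 * #|J'| = 2 * e.-1 * (#|J'| * v))%N; last by ring.
  rewrite (_ : k * #|vsupp J'| = 2 * e.-1 * (e * #|vsupp J'|))%N; last first.
    by rewrite /k; ring.
  by rewrite leq_mul2l J'v orbT.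
have p20 : 0 < p2 by rewrite invr_gt0 !mulr_gt0.
have zp : z * p1 <= p2 / 2.
  rewrite /p1 /p2 ex !exprD.
  move: (z ^+ (2 * e * (v - 2))) (zn0 (2 * e * (v - 2))%N) => x x0.
  move: (z ^+ _.-2) (z1n (2 * (2 * e - v)).-2) => y y1.
  have y0 : 0 < y by exact: lt_le_trans y1.
  have -> : (8 * e%:R * x)^-1 / 2 = z ^+ 2 * y / (16 * e%:R) / (x * (z ^+ 2 * y)) :> R.
    by field; rewrite !gt_eqF.
  rewrite [leLHS]mulrA; apply: ler_wpM2r.
    by rewrite invr_ge0 !mulr_ge0 ?sqr_ge0 ?ltW.
  rewrite ler_pdivlMr ?mulr_gt0//.
  have cE : c%:R = 16 * e%:R * B%:R :> R by rewrite /c !natrM.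
  rewrite cE in cz.
  have -> : z * B%:R * (16 * e%:R) = z * (16 * e%:R * B%:R) :> R by ring.
  apply: (@le_trans _ _ (z ^+ 2)); first by rewrite expr2; exact: ler_wpM2l.
  by rewrite ler_peMr// ltW.
have lower p0 : fractional_feasible (free_graphs F n) p0 -> p2 / 2 <= p0.
  apply: (@fractional_free_graphs_ge R W F J) => //.
    rewrite (ltW p20)/= invf_lt1 ?mulr_gt0//.
    have := z1n (2 * e * (v - 2))%N; nra.
  rewrite -eE -vE !natrM natrX -zk -exprM /p2 exprVn exprMn -exprM.
  have -> : (2 * e * (v - 2) * e.-1 = k * (v - 2))%N by rewrite /k mulnAC.
  have E8 : 8 * e%:R <= (8 * e%:R) ^+ e.-1 :> R.
    rewrite -[leLHS]expr1; apply: ler_weXn2l; last by rewrite -ltnS prednK// ltnW.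
    lra.
  rewrite ler_pdivrMr ?mulr_gt0//; last by rewrite exprn_gt0// mulr_gt0.
  rewrite !mulrA; apply: ler_wpM2r; first exact: ltW.
  lra.
have step : forall p0, fractional_feasible (free_graphs F n) p0 ->
    z * threshold (free_graphs F n) <= p0.
  move=> p0 /lower; apply: le_trans; apply: le_trans zp.
  by apply: ler_wpM2l.
have FT := setT_free_graphs F Wn.
split; apply: step.
  by apply: expectation_fractional_feasible; case: (@expectation_thresholdP R _ _ FT).
by case: (@fractional_expectation_thresholdP R _ _ FT).
Qed.
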